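(* Let $\mu$ be the Radon probability measure on $[0,1]$ constructed in the context (regarded as a measure on $\mathbb{R}$). Then: \begin{enumerate} \item $\beta_p(\mu)=0$ for all $0<p\le 1$; \item $\mu$ is $\tfrac18$-porous; \item $\mu$ is mean $(\alpha,1)$-porous for all $0\le\alpha<\tfrac12$. \end{enumerate}
   Context: Construction of $\mu$. For positive integers $i$ set $w(i)=\frac{1}{\log(i+2)}$ (natural logarithm), and $s(i)=w(i)$ if $i$ is odd, $s(i)=1-w(i)$ if $i$ is even. For a binary sequence $j_1\ldots j_i$ let $I_{j_1\ldots j_i}$ be the closed dyadic interval of length $2^{-i}$ whose left endpoint in binary representation is $0.j_1j_2\ldots j_i$. Let $\mu$ be the unique Radon probability measure on $[0,1]$ with \[ \mu(I_{j_1\ldots j_i})=\prod_{k=1}^{i}(1-s(k))^{j_k}s(k)^{1-j_k} \] for all binary sequences $j_1\ldots j_i$. Porosity of sets. $B(x,r)$ is the closed ball. For $A\subset\mathbb{R}$, $x\in\mathbb{R}$, $r>0$ let \[ \mathrm{por}(A,x,r)=\sup\{\alpha\ge0 : B(y,\alpha r)\subset B(x,r)\setminus A\text{ for some }y\in\mathbb{R}\}. \] For $0<p\le1$ the set $A$ is mean $(\alpha,p)$-porous if for every $x\in A$ \[ \liminf_{i\to\infty}\frac{\#\{1\le j\le i : \mathrm{por}(A,x,2^{-j})\ge\alpha\}}{i}\ge p. \] Define \[ \beta_p(\mu)=\sup\{\alpha\ge0 : \mu(A)>0\text{ for some mean }(\alpha,p)\text{-porous set }A\subset\mathbb{R}\}.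 \] (For non-measurable sets, $\mu$ is understood as an outer measure.) Porosity of measures. For $x\in\mathbb{R}$ and $r,\varepsilon>0$ let \[ \mathrm{por}(\mu,x,r,\varepsilon)=\sup\{\alpha\ge 0 : \text{there is } z\in\mathbb{R} \text{ with } B(z,\alpha r)\subset B(x,r)\text{ and }\mu(B(z,\alpha r))\le\varepsilon\mu(B(x,r))\}. \] The measure $\mu$ is $\alpha$-porous at $x$ if $\lim_{\varepsilon\to0}\liminf_{r\to0}\mathrm{por}(\mu,x,r,\varepsilon)\ge\alpha$, and $\mu$ is $\alpha$-porous if there is a set $A$ with $\mu(A)>0$ such that $\mu$ is $\alpha$-porous at every $x\in A$. The measure $\mu$ is mean $(\alpha,p)$-porous at $x$ if \[ \lim_{\varepsilon\to 0}\liminf_{i\to\infty}\frac{\#\{1\le j\le i : \mathrm{por}(\mu,x,2^{-j},\varepsilon)\ge\alpha\}}{i}\ge p, \] and $\mu$ is mean $(\alpha,p)$-porous if there is a set $A$ with $\mu(A)>0$ such that $\mu$ is mean $(\alpha,p)$-porous at every $x\in A$. *)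

(* Defs.v *)
From HB Require Import structures.
From mathcomp Require Import all_boot all_order all_algebra.
From mathcomp Require Import all_classical all_reals all_analysis.
Set Implicit Arguments.
Unset Strict Implicit.
Unset Printing Implicit Defensive.
Import Order.TTheory GRing.Theory Num.Theory.
Import numFieldNormedType.Exports.
Local Open Scope classical_set_scope.
Local Open Scope ring_scope.

Definition w (R : realType) (i : nat) : R := (ln (i + 2)%:R)^-1.

Definition s (R : realType) (i : nat) : R := if odd i then w R i else 1 - w R i.

(* A binary sequence j_1 ... j_i is a [seq bool] of size i, stored from index
   0: [nth false js k] is the digit j_(k+1). *)
Definition dyadic_left (R : realType) (js : seq bool) : R :=
  \sum_(k < size js) (nth false js k)%:R / 2 ^+ k.+1.

Definition dyadic_itv (R : realType) (js : seq bool) : set R :=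
  let a := dyadic_left R js in `[a, a + 2 ^- size js]%classic.

Definition dyadic_mass (R : realType) (js : seq bool) : R :=
  \prod_(k < size js)
    ((1 - s R k.+1) ^+ nth false js k * s R k.+1 ^+ (1 - nth false js k)).

(* These properties determine mu; every Borel probability measure on the real
   line is Radon, so no separate regularity clause is needed. *)
Definition is_dyadic_measure (R : realType)
    (mu : probability (measurableTypeR R) R) : Prop :=
  mu `[0, 1]%classic = 1%E /\
  forall js : seq bool, mu (dyadic_itv js) = (dyadic_mass R js)%:E.

(* The closed ball, with cball x 0 = [set x]; the library's [closed_ball x r]
   is the closure of the open ball, hence empty for r = 0. *)
Definition cball (R : realType) (x r : R) : set R := closed_ball_ Num.norm x r.

(* The suprema below are taken in the extended reals, so the supremum of the
   empty set is -oo. *)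
Definition por_set (R : realType) (A : set R) (x r : R) : \bar R :=
  ereal_sup [set a%:E | a in [set a : R |
    0 <= a /\ exists y, cball y (a * r) `<=` cball x r `\` A]].

(* #{1 <= j <= i : f j >= a} / i *)
Definition scale_freq (R : realType) (f : nat -> \bar R) (a : R) (i : nat) : R :=
  (count (fun j => (a%:E <= f j)%E) (iota 1 i))%:R / i%:R.

Definition mean_porous_set (R : realType) (a p : R) (A : set R) : Prop :=
  forall x, A x ->
    (p%:E <= limn_einf
       (fun i => (scale_freq (fun j => por_set A x (2 ^- j)) a i)%:E))%E.

(* mu^* is the outer measure induced by mu; it agrees with mu on Borel sets. *)
Definition beta (R : realType) (p : R)
    (mu : {measure set (measurableTypeR R) -> \bar R}) : \bar R :=
  ereal_sup [set a%:E | a in [set a : R |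
    0 <= a /\ exists A : set R, mean_porous_set a p A /\ (0 < mu^*%mu A)%E]].

Definition por_measure (R : realType)
    (mu : {measure set (measurableTypeR R) -> \bar R}) (x r e : R) : \bar R :=
  ereal_sup [set a%:E | a in [set a : R |
    0 <= a /\ exists z, cball z (a * r) `<=` cball x r /\
      (mu (cball z (a * r)) <= e%:E * mu (cball x r))%E]].

(* The quantity under the limit e -> 0+ is nondecreasing in e, here and in
   [mean_porous_at], so the limit exists in the extended reals. *)
Definition porous_at (R : realType)
    (mu : {measure set (measurableTypeR R) -> \bar R}) (a x : R) : Prop :=
  (a%:E <= lim (limf_einf (fun r => por_measure mu x r e) 0^'+
                 @[e --> 0^'+]))%E.

Definition porous_measure (R : realType)
    (mu : {measure set (measurableTypeR R) -> \bar R}) (a : R) : Prop :=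
  exists A : set R, (0 < mu^*%mu A)%E /\ forall x, A x -> porous_at mu a x.

Definition mean_porous_at (R : realType)
    (mu : {measure set (measurableTypeR R) -> \bar R}) (a p x : R) : Prop :=
  (p%:E <= lim (limn_einf (fun i =>
                  (scale_freq (fun j => por_measure mu x (2 ^- j) e) a i)%:E)
                 @[e --> 0^'+]))%E.

Definition mean_porous_measure (R : realType)
    (mu : {measure set (measurableTypeR R) -> \bar R}) (a p : R) : Prop :=
  exists A : set R, (0 < mu^*%mu A)%E /\ forall x, A x -> mean_porous_at mu a p x.

(* Main.v *)
(* Let e_k be the event that the k-th digit is the unlikely one (0 for odd k, 1
   for even k); these events are independent with probabilities w(k) -> 0, and a
   typical expansion is 101010... with errors of density zero.

   Porosity of mu: the unlikely half of every dyadic interval of level k carries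
   a fraction w(k+1) of its mass, which gives a hole of relative size 1/8 at every
   scale.  When the digits near scale 2^-j are correct, mu on B(x, 2^-j) is
   concentrated near x, so a half of that ball is almost null; by Chernoff and
   Borel-Cantelli this happens at a set of scales of density one.

   Non-porosity of sets: a hole of A at a scale with correct digits is a dyadic
   interval a bounded number L of levels below an interval I containing x, with a
   fraction of at least (const * w(n))^L of the mass of I when I has level at most
   n.  The intervals that meet A avoid their own holes, so the expected number of
   holes met up to level n is O((log n)^L), which is o(n). *)
Require Import Defs.
From HB Require Import structures.
From mathcomp Require Import all_boot all_order all_algebra.
From mathcomp Require Import all_classical all_reals all_analysis.
From mathcomp Require Import ring lra zify.
(* [dyadic_itv] is also the name of an unrelated constant of the library. *)
Import Defs.
Set Implicit Arguments.
Unset Strict Implicit.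
Unset Printing Implicit Defensive.
Import Order.TTheory GRing.Theory Num.Theory.
Import numFieldNormedType.Exports.
Local Open Scope classical_set_scope.
Local Open Scope ring_scope.

(** * Independent digits *)

Section DigitProbabilities.
Variable R : realType.
Implicit Types (m n k l : nat) (u v : seq bool) (F G : seq bool -> R).

(* [e <= (6/5)^6 < 3], from [5/6 <= exp (-1/6)]. *)
Lemma ln3_gt1 : 1 < ln 3 :> R.
Proof.
have h : expR (6^-1) <= 6 / 5 :> R.
  have := expR_ge1Dx (- 6^-1 : R); rewrite expRN => h.
  have e0 : 0 < expR (6^-1 : R) by exact: expR_gt0.
  have : (1 - 6^-1) * expR (6^-1) <= 1 :> R.
    by rewrite -ler_pdivlMr// mul1r.
  lra.
rewrite -ltr_expR lnK ?posrE//.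
have -> : (1 : R) = 6%:R * 6^-1 by rewrite mulfV.
rewrite expRM_natl (@le_lt_trans _ _ ((6 / 5) ^+ 6))//; last by lra.
by rewrite lerXn2r ?nnegrE ?expR_ge0//; lra.
Qed.

Lemma w_gt0 k : (0 < k)%N -> 0 < w R k.
Proof.
by move=> k0; rewrite /w invr_gt0 ln_gt0 // ltr1n; lia.
Qed.

Lemma w_le k l : (0 < k <= l)%N -> w R l <= w R k.
Proof.
move=> /andP[k0 kl]; rewrite /w lef_pV2 ?posrE ?ln_gt0 ?ltr1n; try lia.
by rewrite ler_ln ?posrE ?ltr0n ?ler_nat; lia.
Qed.

Lemma w1_lt1 : w R 1 < 1.
Proof. by rewrite /w invf_lt1 ?ln3_gt1// (lt_trans _ ln3_gt1). Qed.

Lemma w_lt1 k : (0 < k)%N -> w R k < 1.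
Proof. by move=> k0; rewrite (le_lt_trans _ w1_lt1)// w_le// k0. Qed.

Lemma w_small (e : R) : 0 < e ->
  exists N, forall k, (N <= k)%N -> w R k <= e.
Proof.
move=> e0; exists (Num.truncn (expR e^-1)).+1 => k Nk.
rewrite /w invf_ple ?posrE ?ln_gt0 ?ltr1n//; try lia.
rewrite -[leLHS]expRK ler_ln ?posrE ?expR_gt0 ?ltr0n; try lia.
by rewrite (le_trans (ltW (truncnS_gt _)))// ler_nat (leq_trans Nk)// leq_addr.
Qed.

(** Positions count from 0: position [m] holds the digit j_(m+1), so the likely digit is 1 at even
    [m]. *)
Definition typical_digit m : bool := ~~ odd m.

Definition digit_prob m (b : bool) : R :=
  if b == typical_digit m then 1 - w R m.+1 else w R m.+1.

Lemma digit_prob_gt0 m b : 0 < digit_prob m b.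
Proof. by rewrite /digit_prob; case: ifP; rewrite ?subr_gt0 ?w_lt1 ?w_gt0. Qed.

Lemma digit_prob_sum m : digit_prob m true + digit_prob m false = 1.
Proof. by rewrite /digit_prob /typical_digit; case: (odd m) => /=; ring. Qed.

(** The likely digit has probability at least [1 - w R 1], the unlikely one at least [w R n]; the
    product lies below both. *)
Lemma digit_prob_ge m n b : (m < n)%N -> (1 - w R 1) * w R n <= digit_prob m b.
Proof.
move=> mn; have n0 : (0 < n)%N by lia.
have wn := w_gt0 n0; have w1 := w1_lt1; have w10 : 0 < w R 1 by exact: w_gt0.
have wn1 := w_lt1 n0; rewrite /digit_prob; case: ifP => _.
  have : w R m.+1 <= w R 1 by rewrite w_le.
  by nra.
have : w R n <= w R m.+1 by rewrite w_le//; lia.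
by nra.
Qed.

Fixpoint word_prob m u : R :=
  if u is b :: u' then digit_prob m b * word_prob m.+1 u' else 1.

Lemma word_prob_cat m u v :
  word_prob m (u ++ v) = word_prob m u * word_prob (m + size u) v.
Proof.
elim: u m => [|b u IH] m /=; first by rewrite mul1r addn0.
by rewrite IH mulrA addSnnS.
Qed.

Lemma word_prob_gt0 m u : 0 < word_prob m u.
Proof.
elim: u m => [|b u IH] m /=; first exact: ltr01.
by rewrite mulr_gt0// digit_prob_gt0.
Qed.

Lemma dyadic_massE u : dyadic_mass R u = word_prob 0 u.
Proof.
have H m : \prod_(k < size u) ((1 - s R (m + k).+1) ^+ nth false u k *
    s R (m + k).+1 ^+ (1 - nth false u k)) = word_prob m u.
  elim: u m => [|b u IH] m /=; first by rewrite big_ord0.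
  rewrite big_ord_recl /= addn0 -IH; congr (_ * _).
    rewrite /digit_prob /typical_digit /s /=.
    by case: b; case: (odd m);
      rewrite /= ?subn0 ?subnn ?expr0 ?expr1 ?mulr1 ?mul1r ?subKr.
  by apply: eq_bigr => k _; rewrite /bump /= add0n add1n addSnnS.
exact: (H 0%N).
Qed.

Lemma word_prob_ge m n u : (m + size u <= n)%N ->
  ((1 - w R 1) * w R n) ^+ size u <= word_prob m u.
Proof.
elim: u m => [|b u IH] m /= h; first by rewrite expr0.
have n0 : (0 < n)%N by lia.
have a0 : 0 <= (1 - w R 1) * w R n.
  by rewrite mulr_ge0// ?subr_ge0 ltW// ?w1_lt1// w_gt0.
rewrite exprS ler_pM ?exprn_ge0//; first by apply: digit_prob_ge; lia.
by apply: IH; lia.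
Qed.

(** The expectation over the independent digits at positions m, ..., m + n - 1, as a finite
    recursion, so that the probabilistic estimates involve no integral. *)
Fixpoint expect m n F : R :=
  if n is n'.+1 then
    digit_prob m true * expect m.+1 n' (F \o cons true) +
    digit_prob m false * expect m.+1 n' (F \o cons false)
  else F [::].

Lemma expect_le m n F G : (forall u, size u = n -> F u <= G u) ->
  expect m n F <= expect m n G.
Proof.
elim: n m F G => [|n IH] m F G FG /=; first exact: FG.
by rewrite lerD// ler_pM2l ?digit_prob_gt0//; apply: IH => u su;
  rewrite /= FG//= su.
Qed.

Lemma eq_expect m n F G : (forall u, size u = n -> F u = G u) ->
  expect m n F = expect m n G.
Proof.
by move=> FG; apply/eqP; rewrite eq_le !expect_le// => u su; rewrite FG.
Qed.

Lemma expectD m n F G :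
  expect m n (fun u => F u + G u) = expect m n F + expect m n G.
Proof.
elim: n m F G => [//|n IH] m F G /=.
rewrite (IH _ (F \o cons true) (G \o cons true)).
rewrite (IH _ (F \o cons false) (G \o cons false)); ring.
Qed.

Lemma expectZ m n c F : expect m n (fun u => c * F u) = c * expect m n F.
Proof.
elim: n m F => [//|n IH] m F /=.
by rewrite (IH _ (F \o cons true)) (IH _ (F \o cons false)); ring.
Qed.

Lemma expect_cst m n c : expect m n (fun=> c) = c.
Proof.
elim: n m => [//|n IH] m /=.
by rewrite !IH -mulrDl digit_prob_sum mul1r.
Qed.

Lemma expect_sum m n k (F : nat -> seq bool -> R) :
  expect m n (fun u => \sum_(i < k) F i u) = \sum_(i < k) expect m n (F i).
Proof.
elim: k => [|k IH].
  rewrite big_ord0 -[RHS](expect_cst m n).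
  by apply: eq_expect => u _; rewrite big_ord0.
rewrite big_ord_recr /= -IH -expectD.
by apply: eq_expect => u _; rewrite big_ord_recr.
Qed.

Lemma expect_cat m n k F : expect m (n + k) F =
  expect m n (fun u => expect (m + n) k (fun v => F (u ++ v))).
Proof.
elim: n m F => [|n IH] m F /=; first by rewrite addn0.
by rewrite !IH; congr (_ * _ + _ * _); apply: eq_expect => u _;
  rewrite addSnnS.
Qed.

Lemma expect_take m n k F : (k <= n)%N ->
  expect m n (fun u => F (take k u)) = expect m k F.
Proof.
move=> kn; rewrite -(subnKC kn) expect_cat.
apply: eq_expect => u su.
rewrite -[RHS](expect_cst (m + k) (n - k)); apply: eq_expect => v _.
by rewrite take_cat su ltnn subnn take0 cats0.
Qed.

(** Along the letters of [u], each branch leaving [u] contributes at most its probability, and the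
    leaf [u] contributes nothing. *)
Lemma expect_avoid m F u : (forall v, F v <= 1) -> F u = 0 ->
  expect m (size u) F <= 1 - word_prob m u.
Proof.
elim: u m F => [|b u IH] m F F1 Fu /=; first by rewrite Fu subrr.
have {}IH := IH m.+1 (F \o cons b) (fun v => F1 _) Fu.
have other c : expect m.+1 (size u) (F \o cons c) <= 1.
  by rewrite -[leRHS](expect_cst m.+1 (size u)); apply: expect_le => v _ /=.
have st := digit_prob_sum m.
have dt := digit_prob_gt0 m true; have df := digit_prob_gt0 m false.
have pu := word_prob_gt0 m.+1 u.
case: b IH {Fu} => IH.
  have := other false; nra.
have := other true; nra.
Qed.

End DigitProbabilities.

(** * Counting errors *)

Section ErrorCount.
Variable R : realType.
Implicit Types (m n k l q : nat) (u v : seq bool).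

Fixpoint nerr m u : nat :=
  if u is b :: u' then (b != typical_digit m) + nerr m.+1 u' else 0.

Lemma nerrE m u :
  nerr m u = (\sum_(k < size u) (nth false u k != typical_digit (m + k)))%N.
Proof.
elim: u m => [|b u IH] m /=; first by rewrite big_ord0.
rewrite big_ord_recl /= addn0 IH; congr addn.
by apply: eq_bigr => k _; rewrite /bump /= add0n add1n addSnnS.
Qed.

Lemma nerr_cat m u v : nerr m (u ++ v) = (nerr m u + nerr (m + size u) v)%N.
Proof.
elim: u m => [|b u IH] m /=; first by rewrite addn0.
by rewrite IH addnA addSnnS.
Qed.

(** By independence each digit contributes a factor (1 - w) + t w; this is the generating function
    for Chernoff's bound. *)
Lemma expect_exp_nerr m n (t : R) :
  expect m n (fun u => t ^+ nerr m u) =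
  \prod_(k < n) (1 + (t - 1) * w R (m + k).+1).
Proof.
elim: n m => [|n IH] m /=; first by rewrite big_ord0.
rewrite big_ord_recl /= addn0.
have -> : \prod_(i < n) (1 + (t - 1) * w R (m + bump 0 i).+1) =
    expect m.+1 n (fun u => t ^+ nerr m.+1 u).
  by rewrite IH; apply: eq_bigr => k _; rewrite /bump /= add1n addSnnS.
have E c : expect m.+1 n ((fun u => t ^+ nerr m u) \o cons c) =
    t ^+ (c != typical_digit m) * expect m.+1 n (fun u => t ^+ nerr m.+1 u).
  by rewrite -expectZ; apply: eq_expect => u _ /=; rewrite exprD.
rewrite !E /digit_prob /typical_digit.
by case: (odd m); rewrite /= !expr1 !expr0; ring.
Qed.

(* Chernoff's bound with base [2 ^ q]: [n <= q * e] gives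
   [1 <= (2 ^ q) ^ e / 2 ^ n]. *)
Lemma expect_many_errors q n :
  expect 0 n (fun u => (n <= q * nerr 0 u)%N%:R) <=
  \prod_(k < n) ((1 + (2 ^+ q - 1) * w R k.+1) / 2).
Proof.
rewrite big_split /= -(expect_exp_nerr 0 n (2 ^+ q)) mulrC -expectZ.
apply: expect_le => u _.
rewrite prodr_const card_ord -exprM exprVn.
case: leqP => h; last by rewrite mulr_ge0 ?invr_ge0 ?exprn_ge0.
by rewrite mulrC ler_pdivlMr ?exprn_gt0// mul1r ler_weXn2l// ler1n.
Qed.

Lemma geometric_tail (x : nat -> R) (c : R) (N : nat) : 0 < c ->
  (forall k, 0 <= x k) -> (forall k, (N <= k)%N -> x k <= c) ->
  exists2 C, 0 <= C & forall n, (N <= n)%N -> \prod_(k < n) x k <= C * c ^+ n.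
Proof.
move=> c0 x0 xc; exists (\prod_(k < N) x k / c ^+ N).
  by rewrite divr_ge0 ?exprn_ge0 ?prodr_ge0// ltW.
move=> n; elim: n => [|n IH].
  by rewrite leqn0 => /eqP ->; rewrite !big_ord0 expr0 divr1 mulr1.
rewrite leq_eqVlt => /predU1P[->|Nn].
  by rewrite divfK// expf_neq0// gt_eqF.
rewrite big_ord_recr /= exprSr mulrA ler_pM ?prodr_ge0//; first exact: IH.
exact: xc.
Qed.

Lemma many_errors_rare q : exists N, exists2 C : R, 0 <= C & forall n, (N <= n)%N ->
  expect 0 n (fun u => (n <= q * nerr 0 u)%N%:R) <= C * (3 / 4) ^+ n.
Proof.
(* If w is at most this number then (2^q - 1) w <= 1/2, and the factor in Chernoff's bound is at
   most (1 + 1/2) / 2 = 3/4. *)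
have d0 : 0 < (2 * 2 ^+ q)^-1 :> R by rewrite invr_gt0 mulr_gt0 ?exprn_gt0.
have [N HN] := w_small d0; exists N.
pose x k : R := (1 + (2 ^+ q - 1) * w R k.+1) / 2.
have q1 : 1 <= 2 ^+ q :> R by rewrite exprn_ege1// ler1n.
have wp k : 0 < w R k.+1 by exact: w_gt0.
have x0 k : 0 <= x k.
  by rewrite /x divr_ge0// addr_ge0// mulr_ge0 ?subr_ge0// ltW.
have xs k : (N <= k)%N -> x k <= 3 / 4.
  move=> Nk; have : w R k.+1 <= (2 * 2 ^+ q)^-1 by apply: HN; rewrite leqW.
  have wk := wp k; rewrite /x -div1r ler_pdivlMr ?mulr_gt0 ?(lt_le_trans _ q1)//.
  nra.
have c0 : 0 < 3 / 4 :> R by lra.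
have [C C0 HC] := geometric_tail c0 x0 xs.
by exists C => // n /HC; apply: le_trans; exact: expect_many_errors.
Qed.

(** Union bound: each of the [size u] digits is wrong with probability at most [e]. *)
Lemma word_prob_typical_ge (e : R) m u : 0 <= e -> nerr m u = 0%N ->
  (forall k, (m < k)%N -> w R k <= e) -> 1 - (size u)%:R * e <= word_prob R m u.
Proof.
elim: u m => [|b u IH] m e0 /= un we; first by rewrite mul0r subr0.
move/eqP: un; rewrite addn_eq0 => /andP[/eqP bt /eqP un].
have {}IH := IH m.+1 e0 un (fun k mk => we k (ltnW mk)).
have wm : w R m.+1 <= e by exact: we.
have w0 : 0 < w R m.+1 by exact: w_gt0.
have w1 : w R m.+1 < 1 by exact: w_lt1.
rewrite /digit_prob; move: bt; case: eqP => //= _ _.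
have p0 := word_prob_gt0 R m.+1 u; rewrite -natr1.
have p1 : word_prob R m.+1 u <= 1.
  elim: u (m.+1) {IH un p0} => [//|c u IH] k /=.
  have c0 := digit_prob_gt0 R k c.
  have c1 : digit_prob R k c <= 1.
    have := digit_prob_sum R k; have := digit_prob_gt0 R k (~~ c).
    case: c {c0} => /=; lra.
  have := IH k.+1; have := word_prob_gt0 R k.+1 u; nra.
nra.
Qed.

(* Every scale where [P] fails is charged to an error in a window of [l] digits,
   and each error is charged at most [l] times. *)
Lemma count_bad_windows l J n u (P : pred nat) : (n + l <= (size u).+2)%N ->
  (2 <= J)%N ->
  (forall j, (J <= j <= n)%N -> nerr (j - 2) (take l (drop (j - 2) u)) = 0%N -> P j) ->
  (n <= count P (iota 1 n) + J + l * nerr 0 u)%N.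
Proof.
move=> nl J2 HP.
pose err k : nat := nth false u k != typical_digit k.
pose E x := (\sum_(k < x) err k)%N.
have E_le x : (x <= size u)%N -> (E x <= nerr 0 u)%N.
  move=> xu; rewrite nerrE -(subnKC xu) big_split_ord /=.
  exact: leq_addr.
(* Passing from [i] to [i.+1] adds to the last sum the errors at positions i - 1, ..., i + l - 2,
   which form the window of scale [i.+1]. The scales below [J] are absorbed by the term [J]. *)
have key i : (i <= n)%N ->
    (i <= count P (iota 1 i) + J + \sum_(t < l) E (i.-1 + t))%N.
  elim: i => [//|i IH] iln; have {}IH := IH (ltnW iln).
  have [iJ|Ji] := ltnP i.+1 J; first by rewrite -addnA ltn_addl// ltn_addr// ltnW.
  have cS : count P (iota 1 i.+1) = (count P (iota 1 i) + P i.+1)%N.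
    by rewrite -[X in iota _ X]addn1 iotaD count_cat /= addn0 add1n.
  have ES : (\sum_(t < l) E (i.+1.-1 + t) =
      \sum_(t < l) E (i.-1 + t) + \sum_(t < l) err (i.-1 + t))%N.
    rewrite -big_split /=; apply: eq_bigr => t _.
    have -> : (i + t = (i.-1 + t).+1)%N by lia.
    by rewrite /E big_ord_recr.
  have [Pi|nPi] := boolP (P i.+1); first by rewrite cS Pi ES; lia.
  suff : (0 < \sum_(t < l) err (i.-1 + t))%N by rewrite cS ES; lia.
  rewrite lt0n; apply: contra nPi => /eqP s0; apply: HP; first by rewrite Ji.
  have -> : (i.+1 - 2 = i.-1)%N by lia.
  rewrite nerrE size_takel ?size_drop; last by lia.
  rewrite -[RHS]s0; apply: eq_bigr => t _.
  by rewrite nth_take// nth_drop.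
have [->//|n0] := posnP n.
apply: leq_trans (key n (leqnn n)) _; rewrite leq_add2l.
apply: (@leq_trans (\sum_(t < l) nerr 0 u)%N); last by rewrite sum_nat_const card_ord.
by apply: leq_sum => t _; apply: E_le; have := ltn_ord t; lia.
Qed.

End ErrorCount.

(** * Geometry of dyadic intervals *)

Section DyadicIntervals.
Variable R : realType.
Implicit Types (u v : seq bool) (x y r : R).

Lemma dyadic_left_nil : dyadic_left R [::] = 0.
Proof. by rewrite /dyadic_left big_ord0. Qed.

Lemma dyadic_left_cons b u :
  dyadic_left R (b :: u) = (b%:R + dyadic_left R u) / 2.
Proof.
rewrite /dyadic_left /= big_ord_recl /= mulrDl; congr (_ + _).
rewrite mulr_suml; apply: eq_bigr => k _.
by rewrite /bump /= add1n exprSr invfM mulrA.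
Qed.

Lemma dyadic_left_cat u v :
  dyadic_left R (u ++ v) = dyadic_left R u + dyadic_left R v / 2 ^+ size u.
Proof.
elim: u => [|b u IH] /=; first by rewrite dyadic_left_nil add0r divr1.
by rewrite !dyadic_left_cons IH exprSr invfM; ring.
Qed.

Lemma dyadic_left_bounds u : 0 <= dyadic_left R u <= 1 - 2 ^- size u.
Proof.
elim: u => [|b u IH] /=; first by rewrite dyadic_left_nil expr0 invr1; lra.
rewrite dyadic_left_cons exprS invfM.
have : 0 < 2 ^- size u :> R by rewrite invr_gt0 exprn_gt0.
by case: b => /=; lra.
Qed.

Lemma dyadic_itvP u x : dyadic_itv u x <->
  dyadic_left R u <= x <= dyadic_left R u + 2 ^- size u.
Proof. by rewrite /dyadic_itv /= in_itv. Qed.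

(** Self-similarity under the affine map of I_u onto [0,1]; it reduces refinement inside I_u to
    covering the unit interval. *)
Lemma dyadic_itv_catP u v x : dyadic_itv (u ++ v) x <->
  dyadic_itv v ((x - dyadic_left R u) * 2 ^+ size u).
Proof.
have p0 : 0 < 2 ^+ size u :> R by rewrite exprn_gt0.
rewrite !dyadic_itvP dyadic_left_cat size_cat exprD invfM.
rewrite -addrA.
have E a : (dyadic_left R u + a / 2 ^+ size u <= x) =
    (a <= (x - dyadic_left R u) * 2 ^+ size u).
  by rewrite -lerBrDl ler_pdivrMr.
have E' a : (x <= dyadic_left R u + a / 2 ^+ size u) =
    ((x - dyadic_left R u) * 2 ^+ size u <= a).
  by rewrite -lerBlDl ler_pdivlMr.
by rewrite [_^-1 * _]mulrC -mulrDl E E'.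
Qed.

Lemma dyadic_itv_catW u v : dyadic_itv (u ++ v) `<=` @dyadic_itv R u.
Proof.
move=> x /dyadic_itvP; rewrite dyadic_left_cat size_cat exprD invfM => h.
apply/dyadic_itvP; have /andP[a b] := dyadic_left_bounds v.
have p0 : 0 < 2 ^- size u :> R by rewrite invr_gt0 exprn_gt0.
nra.
Qed.

Lemma dyadic_itv_unit u : @dyadic_itv R u `<=` `[0, 1].
Proof.
move=> x /(@dyadic_itv_catW [::]) /dyadic_itvP.
by rewrite dyadic_left_nil expr0 invr1 add0r /= in_itv.
Qed.

Lemma unit_dyadic_cover n x : 0 <= x <= 1 ->
  exists2 u, size u = n & dyadic_itv u x.
Proof.
elim: n x => [|n IH] x x01.
  by exists [::] => //; apply/dyadic_itvP; rewrite dyadic_left_nil expr0; lra.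
(* The doubling map shifts the expansion. The midpoint lies in both closed halves and is assigned to
   the left one. *)
have [x2|x2] := leP (x * 2) 1.
  have [|u su /dyadic_itvP ux] := IH (x * 2); first lra.
  exists (false :: u); first by rewrite /= su.
  by apply/dyadic_itvP; rewrite dyadic_left_cons exprS invfM/=; lra.
have [|u su /dyadic_itvP ux] := IH (x * 2 - 1); first lra.
exists (true :: u); first by rewrite /= su.
by apply/dyadic_itvP; rewrite dyadic_left_cons exprS invfM/=; lra.
Qed.

Lemma dyadic_itv_refine n u x : dyadic_itv u x ->
  exists2 v, size v = n & dyadic_itv (u ++ v) x.
Proof.
rewrite -{1}[u]cats0 => /dyadic_itv_catP /dyadic_itv_unit.
rewrite /= in_itv => /(unit_dyadic_cover n)[v sv vx].
by exists v => //; apply/dyadic_itv_catP.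
Qed.

Lemma cballP x r y : cball x r y <-> x - r <= y <= x + r.
Proof. by rewrite /cball /closed_ball_ /= distrC ler_distl. Qed.

Lemma dyadic_itv_sub_cball u x r : dyadic_itv u x -> 2 ^- size u <= r ->
  dyadic_itv u `<=` cball x r.
Proof.
move=> /dyadic_itvP xu ur y /dyadic_itvP yu; apply/cballP; lra.
Qed.

(* Two correct digits [10] or [01] after position [m] keep [x] at distance at
   least a quarter of the interval's length from both of its endpoints. *)
Lemma cball_sub_dyadic_itv u m x : (m.+2 <= size u)%N ->
  nerr m (take 2 (drop m u)) = 0%N -> dyadic_itv u x ->
  cball x (2 ^- m.+2) `<=` dyadic_itv (take m u).
Proof.
move=> mu + ux y /cballP xy.
have sv : size (take m u) = m by rewrite size_takel//; lia.
have : size (drop m u) = (size u - m)%N by rewrite size_drop.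
case E : (drop m u) => [|b [|c t]] /=; [lia | lia | move=> _].
rewrite take0 /= addn0 /typical_digit /= => /eqP; rewrite addn_eq0.
have eu : u = take m u ++ [:: b, c & t] by rewrite -E cat_take_drop.
move: ux; rewrite {1}eu => /dyadic_itvP.
rewrite dyadic_left_cat size_cat sv !dyadic_left_cons => ux bc.
apply/dyadic_itvP; rewrite sv.
have /andP[t0 t1] := dyadic_left_bounds t.
have p0 : 0 < 2 ^- m :> R by rewrite invr_gt0 exprn_gt0.
have q0 : 0 < 2 ^- size t :> R by rewrite invr_gt0 exprn_gt0.
move: p0 q0 t0 t1 ux xy; rewrite /= !exprS exprD !exprS !invfM.
set A := dyadic_left _ _; set B := dyadic_left _ _.
set P := (2 ^+ m)^-1; set Q := (2 ^+ size t)^-1 => p0 q0 t0 t1 ux xy.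
have PA : 0 <= P * A by rewrite mulr_ge0// ltW.
have PQ : P * A + P * Q <= P by rewrite -mulrDr -[leRHS]mulr1 ler_pM2l//; lra.
(* Consecutive typical digits differ, so exactly one of [b], [c] is 1 and [x] lies in the middle
   half of the interval. *)
have bc1 : (b%:R + c%:R = 1 :> R).
  move: bc {E eu ux}; case: b; case: c; case: (odd m) => //= _;
    by rewrite ?addr0 ?add0r.
have b01 : b%:R = 0 :> R \/ b%:R = 1 :> R by case: (b); [right|left].
have cE : c%:R = 1 - b%:R :> R by apply/eqP; rewrite eq_sym subr_eq addrC bc1.
by move: ux xy; rewrite cE; case: b01 => ->; lra.
Qed.

Lemma dyadic_itv_cball u :
  dyadic_itv u = cball (dyadic_left R u + 2 ^- (size u).+1) (2 ^- (size u).+1).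
Proof.
rewrite eqEsubset; split=> y.
  by move/dyadic_itvP => h; apply/cballP; rewrite exprS invfM; lra.
by move/cballP; rewrite exprS invfM => h; apply/dyadic_itvP; lra.
Qed.

End DyadicIntervals.

(** * Outer measure of unions of dyadic intervals *)

Section OuterMeasure.
Variables (R : realType) (mu : probability (measurableTypeR R) R).
Implicit Types (A : set R) (u v : seq bool).

Lemma le_outer A B : A `<=` B -> (mu^*%mu A <= mu^*%mu B)%E.
Proof. exact: (@le_outer_measure _ _ (mu_ext mu) A B). Qed.

Lemma outerU A B : (mu^*%mu (A `|` B) <= mu^*%mu A + mu^*%mu B)%E.
Proof. exact: (@outer_measureU2 _ _ (mu_ext mu) A B). Qed.

Lemma outer_bigcup0 (F : (set R)^nat) :
  (forall n, mu^*%mu (F n) = 0%E) -> mu^*%mu (\bigcup_n F n) = 0%E.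
Proof.
move=> F0; apply/eqP; rewrite eq_le outer_measure_ge0 andbT.
apply: le_trans (outer_measure_sigma_subadditive (mu_ext mu) F) _.
by rewrite eseries0// => n _ _; exact: F0.
Qed.

Lemma outer_sub0 A B : A `<=` B -> mu^*%mu B = 0%E -> mu^*%mu A = 0%E.
Proof.
move=> AB B0; apply/eqP; rewrite eq_le outer_measure_ge0 andbT -B0.
exact: le_outer.
Qed.

(** Borel-Cantelli for the outer measure: by countable subadditivity the limsup set is bounded by
    every tail of a geometric series. *)
Lemma geometric_outer_limsup (S : (set R)^nat) (C c : R) N :
  0 <= C -> 0 < c < 1 ->
  (forall n, (N <= n)%N -> (mu^*%mu (S n) <= (C * c ^+ n)%:E)%E) ->
  mu^*%mu (\bigcap_m \bigcup_(n in ~` `I_m) S n) = 0%E.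
Proof.
move=> C0 /andP[c0 c1] SC; apply/eqP; rewrite eq_le outer_measure_ge0 andbT.
have tail m : (N <= m)%N ->
    (mu^*%mu (\bigcap_m \bigcup_(n in ~` `I_m) S n) <=
      (C / (1 - c) * c ^+ m)%:E)%E.
  move=> Nm; apply: le_trans (le_outer (_ : _ `<=` \bigcup_(n in ~` `I_m) S n)) _.
    by move=> x; exact.
  apply: le_trans (outer_measure_sigma_subadditive_tail (mu_ext mu) m S) _.
  apply: lime_le; first by apply: is_cvg_nneseries => n _ _; exact: outer_measure_ge0.
  near=> n; have mn : (m <= n)%N by near: n; exists m.
  apply: (@le_trans _ _ (\sum_(m <= i < n) (C * c ^+ i)%:E)%E).
    rewrite big_nat [leRHS]big_nat; apply: lee_sum => i /andP[mi _].
    by apply: SC; exact: leq_trans mi.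
  rewrite sumEFin lee_fin -mulr_sumr mulrAC -mulrA ler_wpM2l//.
  rewrite ler_pdivlMr ?subr_gt0// mulrC mulr_sumr.
  rewrite (eq_bigr (fun i => - (c ^+ i.+1 - c ^+ i))); last first.
    by move=> i _; rewrite exprS; ring.
  by rewrite sumrN telescope_sumr// opprB lerBlDr lerDl exprn_ge0// ltW.
have : (C / (1 - c) * c ^+ m)%:E @[m --> \oo] --> 0%E.
  apply: cvg_EFin; first by near=> k.
  rewrite /comp /= -[X in _ --> X](mulr0 (C / (1 - c))).
  by apply: cvgMr; apply: cvg_expr; rewrite gtr0_norm.
move=> h; set L := mu_ext _ _.
suff : (L <= limn (fun m => (C / (1 - c) * c ^+ m)%:E))%E.
  by rewrite (cvg_lim _ h).
apply: lime_ge; first by apply/cvg_ex; exists 0%E.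
by near=> m; apply: tail; near: m; exists N.
Unshelve. all: by end_near. Qed.

Hypothesis hmu : is_dyadic_measure mu.

Lemma mu_dyadic_itv v : mu (dyadic_itv v) = (word_prob R 0 v)%:E.
Proof. by rewrite hmu.2 dyadic_massE. Qed.

Lemma measurable_dyadic_itv v :
  measurable (dyadic_itv v : set (measurableTypeR R)).
Proof. exact: measurable_itv. Qed.

(** The bridge from [mu] to the finite expectations, by splitting [A] according to the next digit.
    Shared endpoints of the closed intervals do no harm to an upper bound. *)
Lemma outer_dyadic_cover A n v (P : pred (seq bool)) :
  (forall x, A x -> exists u, [/\ size u = n, P u & dyadic_itv (v ++ u) x]) ->
  (mu^*%mu A <=
    (word_prob R 0 v * expect (size v) n (fun u => (P u)%:R))%:E)%E.
Proof.
elim: n v A P => [|n IH] v A P AP.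
  have [Pn|nPn] := boolP (P [::]); last first.
    rewrite (_ : A = set0) ?outer_measure0 /= ?(negbTE nPn) ?mulr0//.
    apply/eqP/negPn/negP => /set0P[x /AP[u [/size0nil -> Pu _]]].
    by rewrite Pu in nPn.
  rewrite /= Pn mulr1 -mu_dyadic_itv -measurable_mu_extE; last first.
    exact: measurable_dyadic_itv.
  apply: le_outer => x /AP[u [/size0nil -> _]].
  by rewrite cats0.
pose Ab b := [set x | exists u, [/\ size u = n, P (b :: u) &
  dyadic_itv (rcons v b ++ u) x] ] : set R.
have AU : A `<=` Ab true `|` Ab false.
  move=> x /AP[[|b u] [//= [su] Pu xu]].
  by case: b Pu xu => Pu xu; [left|right]; exists u; rewrite cat_rcons.
apply: le_trans (le_outer AU) _.
apply: le_trans (outerU (Ab true) (Ab false)) _.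
rewrite /= mulrDr EFinD leeD//.
  have := IH (rcons v true) (Ab true) (P \o cons true) (fun x h => h).
  by rewrite size_rcons -cats1 word_prob_cat /= add0n mulr1 mulrA.
have := IH (rcons v false) (Ab false) (P \o cons false) (fun x h => h).
by rewrite size_rcons -cats1 word_prob_cat /= add0n mulr1 mulrA.
Qed.

Lemma outer_unit_compl : mu^*%mu (~` `[0, 1]%classic) = 0%E.
Proof.
have m01 : measurable (`[0, 1]%classic : set (measurableTypeR R)).
  exact: measurable_itv.
rewrite measurable_mu_extE; last exact: measurableC.
by apply: etrans (probability_setC mu m01) _; rewrite hmu.1 subee.
Qed.

Lemma outer_unit : mu^*%mu `[0, 1]%classic = 1%E.
Proof.
have m01 : measurable (`[0, 1]%classic : set (measurableTypeR R)).
  exact: measurable_itv.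
by rewrite measurable_mu_extE//; exact: hmu.1.
Qed.

(** A dyadic rational may have two words of length [n]; one bad word suffices here, so outside this
    set every word of the point is good. *)
Definition many_errors q n : set R :=
  [set x | exists u, [/\ size u = n, (n <= q * nerr 0 u)%N & dyadic_itv u x] ].

Lemma outer_many_errors q : exists N, exists2 C : R, 0 <= C &
  forall n, (N <= n)%N -> (mu^*%mu (many_errors q n) <= (C * (3 / 4) ^+ n)%:E)%E.
Proof.
have [N [C C0 NC]] := many_errors_rare R q.
exists N, C => // n /NC h.
apply: le_trans (_ : _ <= (expect 0 n (fun u => (n <= q * nerr 0 u)%N%:R))%:E)%E _;
  last by rewrite lee_fin.
have := @outer_dyadic_cover (many_errors q n) n [::]
  (fun u => (n <= q * nerr 0 u)%N) (fun x h => h).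
by rewrite /= mul1r.
Qed.

End OuterMeasure.

(** * Porosity at every scale *)

Section LimitInferior.
Variable R : realType.
Implicit Types (f : nat -> \bar R) (g h : R -> \bar R).
Local Open Scope ereal_scope.

Lemma limn_einf_ge f a N : (forall n, (N <= n)%N -> a <= f n) ->
  a <= limn_einf f.
Proof.
move=> fa; rewrite /limn_einf -/(limf_einf f \oo) limf_einfE.
apply: le_trans (ereal_sup_ubound _); last first.
  by exists [set n | (N <= n)%N]; [exists N | reflexivity].
by apply: le_ereal_inf_tmp => _ [n Nn <-]; exact: fa.
Qed.

Lemma limn_einf_gt f a : a < limn_einf f ->
  exists N, forall n, (N <= n)%N -> a <= f n.
Proof.
rewrite /limn_einf -/(limf_einf f \oo) limf_einfE => /ereal_sup_gt[_ [V [N _ NV] <-]].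
move=> aV; exists N => n Nn; apply: le_trans (ltW aV) _.
by apply: ereal_inf_lbound; exists n => //; exact: NV.
Qed.

Lemma limn_einf_le f a : (forall n, f n <= a) -> limn_einf f <= a.
Proof.
move=> fa; rewrite /limn_einf -/(limf_einf f \oo) limf_einfE.
apply: ge_ereal_sup => _ [V [N _ NV] <-].
apply: le_trans (fa N); apply: ereal_inf_lbound.
by exists N => //; apply: NV => /=.
Qed.

Lemma limf_einf_right_ge g a d : (0 < d)%R ->
  (forall r, (0 < r < d)%R -> a <= g r) -> a <= limf_einf g 0^'+.
Proof.
move=> d0 ga; rewrite limf_einfE.
apply: le_trans (ereal_sup_ubound _); last first.
  exists [set r : R | (0 < r < d)%R]; last reflexivity.
  near=> r; apply/andP; split=> //.
by apply: le_ereal_inf_tmp => _ [r rd <-]; exact: ga.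
Unshelve. all: by end_near. Qed.

Lemma le_limf_einf g h (F : set (set R)) : (forall r, g r <= h r) ->
  limf_einf g F <= limf_einf h F.
Proof.
move=> gh; rewrite !limf_einfE; apply: ge_ereal_sup => _ [V FV <-].
apply: le_trans (ereal_sup_ubound _); last by exists V; [exact: FV|reflexivity].
apply: le_ereal_inf_tmp => _ [r Vr <-]; apply: le_trans (gh r).
by apply: ereal_inf_lbound; exists r.
Qed.

End LimitInferior.

Lemma nat_above (R : realType) (c : R) : exists n : nat, c <= n%:R.
Proof. by exists (Num.truncn c).+1; exact/ltW/truncnS_gt. Qed.

Lemma dyadic_small (R : realType) (c : R) : 0 < c -> exists K, 2 ^- K <= c.
Proof.
move=> c0; exists (Num.truncn c^-1).+1; rewrite invf_ple ?posrE ?exprn_gt0//.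
apply: le_trans (ltW (truncnS_gt _)) _; rewrite -natrX ler_nat.
exact/ltnW/ltn_expl.
Qed.

Lemma dyadic_scale (R : realType) (r : R) J : 0 < r -> r < 2 ^- J ->
  exists k, [/\ (J <= k)%N, 2 ^- k.+1 <= r & r < 2 ^- k].
Proof.
move=> r0 rJ.
have ex := dyadic_small r0.
case: (ex_minnP ex) => -[|k] kr kmin.
  rewrite expr0 invr1 in kr; exfalso.
  have : 2 ^- J <= 1 :> R by rewrite invf_le1 ?exprn_gt0// exprn_ege1// ler1n.
  lra.
have rk : r < 2 ^- k by rewrite ltNge; apply/negP => /kmin; rewrite ltnn.
exists k; split=> //; rewrite leqNgt; apply/negP => kJ.
have : 2 ^- J <= 2 ^- k.+1 :> R.
  by rewrite lef_pV2 ?posrE ?exprn_gt0// ler_weXn2l// ler1n.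
lra.
Qed.

Section PorousMeasure.
Variables (R : realType) (mu : probability (measurableTypeR R) R).
Hypothesis hmu : is_dyadic_measure mu.
Implicit Types (A : set R) (u v : seq bool) (x y r e : R).

Lemma measurable_cball x r : measurable (cball x r : set (measurableTypeR R)).
Proof.
have -> : cball x r = `[x - r, x + r]%classic.
  by rewrite eqEsubset; split=> y /=; rewrite in_itv /= => /cballP.
exact: measurable_itv.
Qed.

Lemma le_por_measure x r e e' : e <= e' ->
  (por_measure mu x r e <= por_measure mu x r e')%E.
Proof.
move=> ee'; apply: ereal_sup_le => _ [a [a0 [z [zx ze]]] <-]; exists a => //.
split=> //; exists z; split=> //; apply: le_trans ze _.
by rewrite lee_wpmul2r// lee_fin.
Qed.

Lemma por_measure_ge a x r e z : 0 <= a ->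
  cball z (a * r) `<=` cball x r ->
  (mu (cball z (a * r)) <= e%:E * mu (cball x r))%E ->
  (a%:E <= por_measure mu x r e)%E.
Proof.
move=> a0 zx ze; apply: ereal_sup_ubound; exists a => //.
by split=> //; exists z.
Qed.

Lemma por_measure_eighth x e : 0 <= x <= 1 -> 0 < e ->
  exists2 d, 0 < d & forall r, 0 < r < d -> ((1 / 8)%:E <= por_measure mu x r e)%E.
Proof.
move=> x01 e0; have [J wJ] := w_small e0.
exists (2 ^- J); first by rewrite invr_gt0 exprn_gt0.
move=> r /andP[r0 /(dyadic_scale r0)[k [Jk kr rk]]].
have [v sv xv] := unit_dyadic_cover k.+1 x01.
have p0 : 0 < 2 ^- k :> R by rewrite invr_gt0 exprn_gt0.
have vx : dyadic_itv v `<=` cball x r.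
  by apply: dyadic_itv_sub_cball => //; rewrite sv.
(* The unlikely half of [dyadic_itv v] has radius 2^-(k+3), which exceeds r / 8 because r < 2^-k. *)
pose u := v ++ [:: ~~ typical_digit k.+1].
have su : size u = k.+2 by rewrite size_cat sv addn1.
set z := dyadic_left R u + 2 ^- (size u).+1.
have zu : cball z (1 / 8 * r) `<=` dyadic_itv u.
  rewrite dyadic_itv_cball -/z => y /cballP zy; apply/cballP.
  by move: rk; rewrite su !exprS !invfM; lra.
apply: (@por_measure_ge _ _ _ _ z); first lra.
  by apply: subset_trans zu _; apply: subset_trans vx; exact: dyadic_itv_catW.
have m1 : (mu (cball z (1 / 8 * r)) <= mu (dyadic_itv u))%E.
  apply: le_measure => //; rewrite inE;
    [exact: measurable_cball | exact: measurable_dyadic_itv].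
have m2 : (mu (dyadic_itv v) <= mu (cball x r))%E.
  apply: le_measure => //; rewrite inE;
    [exact: measurable_dyadic_itv | exact: measurable_cball].
apply: le_trans m1 _; apply: le_trans (_ : _ <= e%:E * mu (dyadic_itv v))%E _.
  rewrite !mu_dyadic_itv// -EFinM lee_fin word_prob_cat /= add0n sv mulr1.
  rewrite [leRHS]mulrC ler_pM2l ?word_prob_gt0// /digit_prob.
  by case: typical_digit => /=; apply: wJ; lia.
by rewrite lee_wpmul2l// lee_fin ltW.
Qed.

Lemma porous_at_unit x : 0 <= x <= 1 -> porous_at mu (1 / 8) x.
Proof.
move=> x01; rewrite /porous_at.
pose g e := limf_einf (fun r => por_measure mu x r e) 0^'+.
have gm : {in `]0, +oo[ &, nondecreasing_fun g}.
  move=> e e' _ _ ee'; rewrite /g.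
  apply: (@le_limf_einf R (fun r => por_measure mu x r e)) => r.
  exact: le_por_measure.
have b0 : (BRight (0 : R) < +oo)%O by [].
(* By monotonicity in [e] the limit is the infimum over e > 0. *)
have gc := @nondecreasing_at_right_cvge R g 0 +oo%O b0 gm.
rewrite (cvg_lim _ gc)//; apply: le_ereal_inf_tmp => _ [e + <-].
rewrite /= in_itv /= andbT => e0.
have [d d0 dx] := por_measure_eighth x01 e0.
exact: limf_einf_right_ge dx.
Qed.

Lemma porous_measure_eighth : porous_measure mu (1 / 8).
Proof.
exists `[0, 1]%classic; split; first by rewrite outer_unit.
by move=> x; rewrite /= in_itv; exact: porous_at_unit.
Qed.

End PorousMeasure.

(** * Mean porosity at typical points *)

Section TypicalPoints.
Variables (R : realType) (mu : probability (measurableTypeR R) R).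
Hypothesis hmu : is_dyadic_measure mu.
Implicit Types (A : set R) (u v : seq bool) (x y r e a d c : R).

(** The points whose errors have density zero; letting [q] range over the integers leaves only
    countably many exceptional sets. *)
Definition typical : set R := [set x | 0 <= x <= 1 /\
  forall q, exists N, forall n, (N <= n)%N -> ~ many_errors q n x].

Lemma outer_typical : (0 < mu^*%mu typical)%E.
Proof.
pose F q := \bigcap_m \bigcup_(n in ~` `I_m) @many_errors R q n.
have F0 : mu^*%mu (\bigcup_q F q) = 0%E.
  apply: outer_bigcup0 => q; have [N [C C0 NC]] := outer_many_errors hmu q.
  by apply: (geometric_outer_limsup C0 _ NC); lra.
have sub : `[0, 1]%classic `<=` typical `|` \bigcup_q F q.
  move=> x; rewrite /= in_itv => x01; have [|nF] := pselect ((\bigcup_q F q) x).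
    by right.
  left; split=> // q; apply: contrapT => /forallNP h; apply: nF.
  exists q => // m _; have /existsNP[n] := h m.
  move=> /not_implyP[mn /contrapT xn]; exists n => //=.
  by apply/negP; rewrite -leqNgt.
have := le_outer mu sub; rewrite outer_unit// => h.
have := outerU mu typical (\bigcup_q F q).
by rewrite F0 adde0 => /(le_trans h); apply: lt_le_trans; exact: lte01.
Qed.

(** With v the first [m] digits and t the window, the first two digits of t keep the ball inside
    I_v, and nearly all the mass of I_v lies in I_(vt), which contains [x] and has length 2^-K times
    the radius. The condition on [e] and [d] makes the rest of I_v weigh at most [e] times
    I_(vt). *)
Lemma por_measure_typical_digits x u m K e a d :
  0 <= a -> 2 ^- K < 1 - 2 * a -> 0 <= d ->
  1 <= (1 + e) * (1 - K.+2%:R * d) -> 0 <= e ->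
  (forall k, (m < k)%N -> w R k <= d) ->
  (m + K.+2 <= size u)%N -> nerr m (take K.+2 (drop m u)) = 0%N ->
  dyadic_itv u x -> (a%:E <= por_measure mu x (2 ^- m.+2) e)%E.
Proof.
move=> a0 Ka d0 ed e0 wd mu_ ut ux.
set t := take K.+2 (drop m u) in ut *; set v := take m u.
have st : size t = K.+2 by rewrite size_takel// size_drop; lia.
have sv : size v = m by rewrite size_takel//; lia.
have uE : u = (v ++ t) ++ drop K.+2 (drop m u) by rewrite -catA !cat_take_drop.
have tx : dyadic_itv (v ++ t) x by move: ux; rewrite {1}uE => /dyadic_itv_catW.
have bv : cball x (2 ^- m.+2) `<=` dyadic_itv v.
  apply: cball_sub_dyadic_itv ux; first lia.
  have : nerr m (take 2 t ++ drop 2 t) = 0%N by rewrite cat_take_drop.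
  by rewrite nerr_cat take_takel// => /eqP; rewrite addn_eq0 => /andP[/eqP].
have p0 : 0 < 2 ^- m.+2 :> R by rewrite invr_gt0 exprn_gt0.
have rK : 2 ^- (m + K.+2) = 2 ^- m.+2 * 2 ^- K :> R.
  by rewrite -invfM -exprD; congr (_ ^- _); lia.
have K0 : 0 < 2 ^- K :> R by rewrite invr_gt0 exprn_gt0.
have K1 : 2 ^- K <= 1 :> R by rewrite invf_le1 ?exprn_gt0// exprn_ege1// ler1n.
set r := 2 ^- m.+2 in bv p0 rK *.
have tb : dyadic_itv (v ++ t) `<=` cball x r.
  by apply: dyadic_itv_sub_cball => //; rewrite size_cat sv st rK; nra.
(* The hole is the segment from x + r (1 - 2a) to x + r, beyond the reach of an interval at [x]
   shorter than r (1 - 2a). *)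
set z := x + r * (1 - a).
have zx : cball z (a * r) `<=` cball x r.
  by move=> y /cballP zy; apply/cballP; move: zy; rewrite /z; nra.
have zt : cball z (a * r) `&` dyadic_itv (v ++ t) = set0.
  apply/eqP/negPn/negP => /set0P[y [/cballP zy /dyadic_itvP]].
  move/dyadic_itvP: tx; rewrite size_cat sv st rK.
  have : r * 2 ^- K < r * (1 - 2 * a) by rewrite ltr_pM2l.
  move: zy; rewrite /z; nra.
have mz := measurable_cball z (a * r); have mt := @measurable_dyadic_itv R (v ++ t).
have hole : (mu (cball z (a * r)) + mu (dyadic_itv (v ++ t)) <= mu (dyadic_itv v))%E.
  rewrite -measureU//; apply: le_measure; rewrite ?inE.
  - exact: measurableU.
  - exact: measurable_dyadic_itv.
  - move=> y [/zx/bv//|]; exact: dyadic_itv_catW.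
apply: (@por_measure_ge _ _ _ _ _ _ z) => //.
apply: le_trans (_ : _ <= e%:E * mu (dyadic_itv (v ++ t)))%E _; last first.
  rewrite lee_wpmul2l ?lee_fin//; apply: le_measure; rewrite ?inE//.
  exact: measurable_cball.
move: hole; rewrite !mu_dyadic_itv// -leeBrDr// => /le_trans; apply.
rewrite -EFinB -EFinM lee_fin word_prob_cat /= add0n sv.
have := word_prob_typical_ge d0 ut wd; rewrite st => h.
have v0 := word_prob_gt0 R 0 v.
have : 1 <= (1 + e) * word_prob R m t.
  by apply: le_trans ed _; rewrite ler_wpM2l// addr_ge0.
nra.
Qed.

Lemma scale_freq_le1 (f : nat -> \bar R) a i : scale_freq f a i <= 1.
Proof.
rewrite /scale_freq; have [->|i0] := posnP i; first by rewrite mul0r.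
by rewrite ler_pdivrMr ?ltr0n// mul1r ler_nat -[leqRHS](size_iota 1) count_size.
Qed.

Lemma typical_freq x a e c : typical x -> 0 <= a -> a < 1 / 2 -> 0 < e -> 0 < c ->
  exists N, forall i, (N <= i)%N ->
    1 - c <= scale_freq (fun j => por_measure mu x (2 ^- j) e) a i.
Proof.
move=> [x01 xt] a0 a2 e0 c0.
have [K Ka] : exists K, 2 ^- K < 1 - 2 * a.
  have h : 0 < (1 - 2 * a) / 2 by lra.
  by have [K hK] := dyadic_small h; exists K; lra.
(* This solves (1 + e) (1 - (K + 2) d) = 1. *)
pose d := e / (1 + e) / K.+2%:R.
have d0 : 0 < d by rewrite !divr_gt0// addr_gt0.
have ed : 1 <= (1 + e) * (1 - K.+2%:R * d).
  have e1 : 1 + e != 0 by rewrite gt_eqF// addr_gt0.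
  by rewrite /d mulrCA divff ?pnatr_eq0// mulr1 mulrBr mulrCA divff// !mulr1 addrK.
have [M wM] := w_small d0.
(* At most M + 2 scales are lost at the start and K + 2 for each error; [q] and [I] make each loss
   at most c i / 2. *)
have [q qc] := nat_above (4 * K.+2%:R / c).
have [N xN] := xt q.
have [I Ic] := nat_above (2 * M.+2%:R / c).
exists (N + K + I).+1 => i Ni.
have [iN iK iI] : [/\ N <= i, K <= i & I <= i]%N by clear -Ni; split; lia.
(* The window of scale [i] starts at position i - 2 and has K + 2 digits, so it ends at i + K. *)
have [u su ux] := unit_dyadic_cover (i + K) x01.
have eu : (q * nerr 0 u < i + K)%N.
  rewrite ltnNge; apply/negP => h.
  apply: (xN (i + K)%N); first exact: leq_trans iN (leq_addr _ _).
  by exists u.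
pose P j := (a%:E <= por_measure mu x (2 ^- j) e)%E.
have : (i <= count P (iota 1 i) + M.+2 + K.+2 * nerr 0 u)%N.
  apply: count_bad_windows => [||j /andP[Mj ji] ju].
  - by rewrite su !addnS.
  - by [].
  have jE : j = (j - 2).+2 by clear -Mj; lia.
  rewrite jE.
  apply: (por_measure_typical_digits a0 Ka (ltW d0) ed (ltW e0) _ _ ju ux).
    by move=> k jk; apply: wM; clear -Mj jk; lia.
  by clear -su ji jE; lia.
rewrite /scale_freq -/P => cnt.
have i0 : 0 < i%:R :> R by rewrite ltr0n (leq_trans _ Ni).
rewrite ler_pdivlMr//.
have {}cnt : i%:R <= (count P (iota 1 i))%:R + M.+2%:R + K.+2%:R * (nerr 0 u)%:R :> R.
  by rewrite -natrM -!natrD ler_nat.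
have {}eu : q%:R * (nerr 0 u)%:R <= i%:R + K%:R :> R.
  by rewrite -natrM -natrD ler_nat ltnW.
have Ki : K%:R <= i%:R :> R by rewrite ler_nat.
have Ii : I%:R <= i%:R :> R by rewrite ler_nat.
have h1 : 4 * K.+2%:R * (nerr 0 u)%:R <= 2 * i%:R * c.
  have : 4 * K.+2%:R / c * (nerr 0 u)%:R <= 2 * i%:R.
    apply: (@le_trans _ _ (q%:R * (nerr 0 u)%:R)); first by rewrite ler_wpM2r.
    lra.
  by rewrite mulrAC ler_pdivrMr.
have h2 : 2 * M.+2%:R <= i%:R * c.
  by rewrite -ler_pdivrMr// (le_trans Ic).
nra.
Qed.

Lemma mean_porous_at_typical x a : typical x -> 0 <= a -> a < 1 / 2 ->
  mean_porous_at mu a 1 x.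
Proof.
(* The lower frequency is already 1 for each e > 0, so the limit is that of a constant. *)
move=> xt a0 a2; rewrite /mean_porous_at (@lim_near_cst _ _ _ _ _ 1%E)//.
near=> e; apply/eqP; rewrite eq_le; apply/andP; split.
  by apply: limn_einf_le => i; rewrite lee_fin scale_freq_le1.
apply/lee_addgt0Pr => c c0; rewrite -leeBlDr//.
have e0 : 0 < e by near: e; exact: nbhs_right_gt.
have [N xN] := typical_freq xt a0 a2 e0 c0.
by apply: (@limn_einf_ge _ _ _ N) => i Ni; rewrite -EFinB lee_fin xN.
Unshelve. all: by end_near. Qed.

Lemma mean_porous_measure_half a : 0 <= a -> a < 1 / 2 -> mean_porous_measure mu a 1.
Proof.
move=> a0 a2; exists typical; split; first exact: outer_typical.
by move=> x xt; exact: mean_porous_at_typical.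
Qed.

End TypicalPoints.

(** * Holes of mean porous sets *)

(** Powers of the logarithm are o(n): with y = ln X one has X = e^y >= y^(L+1) / (L+1)!, and for
    large [n] the extra factor y exceeds 2 C (L+1)! while X <= 2 n. *)
Lemma w_slow (R : realType) L (C : R) :
  exists N, forall n, (N <= n)%N -> C <= w R (n + L) ^+ L * n%:R.
Proof.
have f0 : 0 < L.+1`!%:R :> R by rewrite ltr0n fact_gt0.
pose Y := Num.max 1 (2 * C * L.+1`!%:R).
exists (L.+2 + (Num.truncn (expR Y)).+1)%N => n Nn.
pose X : R := (n + L + 2)%:R; pose y := ln X.
have X0 : 0 < X by rewrite ltr0n; lia.
have yY : Y <= y.
  rewrite -[Y]expRK ler_ln ?posrE ?expR_gt0//.
  apply: le_trans (ltW (truncnS_gt _)) _; rewrite ler_nat.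
  by apply: leq_trans (leq_trans _ Nn) _; rewrite ?leq_addl// -addnA leq_addr.
have y1 : 1 <= y by rewrite (le_trans _ yY)// le_max lexx.
have yC : 2 * C * L.+1`!%:R <= y by rewrite (le_trans _ yY)// le_max lexx orbT.
have y0 : 0 < y by rewrite (lt_le_trans _ y1).
have yX : y ^+ L.+1 / L.+1`!%:R <= X.
  have := expR_ge1Dxn L (ltW y0); rewrite /y lnK ?posrE// => h; lra.
have nX : X <= 2 * n%:R by rewrite -natrM ler_nat; lia.
rewrite /w -/X -/y exprVn mulrC ler_pdivlMr ?exprn_gt0//.
have : 2 * C * y ^+ L <= 2 * n%:R.
  apply: le_trans nX; apply: le_trans yX.
  rewrite ler_pdivlMr// mulrAC exprS ler_pM2r ?exprn_gt0//.
lra.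
Qed.

Section MeanPorousSets.
Variables (R : realType).
Implicit Types (A : set R) (u v : seq bool) (x y r e a p c K : R).

Definition meets A v : bool := `[< exists2 x, A x & dyadic_itv v x >].

Definition has_hole A L v : bool :=
  `[< exists2 u, size u = L & ~~ meets A (v ++ u) >].

Lemma meets_catW A v u : meets A (v ++ u) -> meets A v.
Proof. by move=> /asboolP[x Ax /dyadic_itv_catW vx]; apply/asboolP; exists x. Qed.

Lemma meets_take A m u : meets A u -> meets A (take m u).
Proof. by rewrite -{1}(cat_take_drop m u); exact: meets_catW. Qed.

(* A point of [A] cannot fall into a hole, so a hole below [v] costs the tree of
   intervals meeting [A] a fraction at least [c] of the mass of [v]; each unit of
   mass is lost at most once, hence is counted for at most [L] values of [m]. *)
Lemma sum_expect_holes A L n c : 0 < c ->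
  (forall m t, (m < n)%N -> size t = L -> c <= word_prob R m t) ->
  \sum_(m < n) expect 0 m (fun v => (meets A v && has_hole A L v)%:R) <= L%:R / c.
Proof.
move=> c0 cw; rewrite ler_pdivlMr// mulrC mulr_sumr.
(* The mass of the level-[m] intervals that meet [A]. *)
pose f m : R := expect 0 m (fun v => (meets A v)%:R).
have f01 m : 0 <= f m <= 1.
  apply/andP; split.
    by rewrite -[leLHS](expect_cst 0 m) expect_le// => u _; rewrite ler0n.
  by rewrite -[leRHS](expect_cst 0 m) expect_le// => u _; rewrite lern1 leq_b1.
have step (m : 'I_n) :
    c * expect 0 m (fun v => (meets A v && has_hole A L v)%:R) <= f m - f (m + L)%N.
  rewrite lerBrDr -expectZ /f expect_cat -expectD; apply: expect_le => v sv.
  rewrite add0n; have [Mv|nMv] := boolP (meets A v); last first.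
    rewrite mulr0 add0r -[leRHS](expect_cst m L); apply: expect_le => u _.
    by rewrite (negbTE (contra (@meets_catW A v u) nMv)).
  have M1 u : (meets A (v ++ u))%:R <= 1 :> R by rewrite lern1 leq_b1.
  have [/asboolP[t tL nt]|_] := boolP (has_hole A L v); last first.
    rewrite mulr0 add0r -[leRHS](expect_cst m L); apply: expect_le => u _.
    exact: M1.
  rewrite mulr1 -tL -lerBrDl.
  apply: le_trans (expect_avoid m M1 _) _; first by rewrite (negbTE nt).
  by rewrite lerD2l lerN2 cw.
apply: (@le_trans _ _ (\sum_(m < n) (f m - f (m + L)%N))); first exact: ler_sum.
(* Telescoping with stride [L] leaves the first [L] values of [f] minus the [L] values from [n]
   on. *)
have split1 : \sum_(m < n + L) f m = \sum_(m < n) f m + \sum_(m < L) f (n + m)%N.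
  by rewrite big_split_ord.
have split2 : \sum_(m < L + n) f m = \sum_(m < L) f m + \sum_(m < n) f (m + L)%N.
  by rewrite big_split_ord /=; congr (_ + _); apply: eq_bigr => m _; rewrite addnC.
rewrite sumrB; move: split2; rewrite addnC split1 => E.
have s0 : 0 <= \sum_(m < L) f (n + m)%N.
  by apply: sumr_ge0 => m _; have /andP[] := f01 (n + m)%N.
have s1 : \sum_(m < L) f m <= L%:R.
  rewrite -[L in leRHS]card_ord -sumr_const; apply: ler_sum => m _.
  by have /andP[] := f01 m.
lra.
Qed.

(** Markov's inequality. If [u] meets [A] then so do its prefixes, so each hole counted here occurs
    in the sum of expectations. *)
Lemma many_holes_rare A L n c K : 0 < c -> 0 < K ->
  (forall m t, (m < n)%N -> size t = L -> c <= word_prob R m t) ->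
  expect 0 n (fun u => (meets A u &&
    (K <= (\sum_(m < n) has_hole A L (take m u))%N%:R))%:R) <= L%:R / (c * K).
Proof.
move=> c0 K0 cw; rewrite invfM mulrA ler_pdivlMr// mulrC -expectZ.
refine (le_trans _ (@sum_expect_holes A L n c c0 cw)).
rewrite (eq_bigr (fun m : 'I_n => expect 0 n (fun u =>
    (meets A (take m u) && has_hole A L (take m u))%:R))); last first.
  move=> m _.
  by rewrite (expect_take _ (fun v => (meets A v && has_hole A L v)%:R))// ltnW.
rewrite -(expect_sum 0 n n (fun m u =>
    (meets A (take m u) && has_hole A L (take m u))%:R)).
apply: expect_le => u _; case: andP => [[Mu Ku]|_]; last first.
  by rewrite mulr0 sumr_ge0// => m _; rewrite ler0n.
rewrite mulr1 (le_trans Ku)// natr_sum; apply: ler_sum => m _.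
by rewrite (meets_take m Mu).
Qed.

(** The centre of the hole lies in the interval of [take m u]. Its descendant of depth [L] through
    that centre has length at most 2^-m a / 8, which is a / 2 times the radius 2^-(m+2), so it fits
    into the hole. *)
Lemma por_set_hole A x a u m L : 0 < a -> 2 ^- L <= a / 8 ->
  (m.+2 <= size u)%N -> nerr m (take 2 (drop m u)) = 0%N -> dyadic_itv u x ->
  (a%:E <= por_set A x (2 ^- m.+2))%E -> has_hole A L (take m u).
Proof.
move=> a0 La mu ut ux ap.
(* The supremum may not be attained, hence the retreat from [a] to a / 2. *)
have : ((a / 2)%:E < por_set A x (2 ^- m.+2))%E.
  by apply: lt_le_trans ap; rewrite lte_fin; lra.
move=> /ereal_sup_gt[_ [b [b0 [y yb]] <-]]; rewrite lte_fin => ab.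
have p0 : 0 < 2 ^- m.+2 :> R by rewrite invr_gt0 exprn_gt0.
have yy : cball y (b * 2 ^- m.+2) y by apply/cballP; nra.
have [yx _] := yb _ yy.
have := cball_sub_dyadic_itv mu ut ux yx.
move=> /(dyadic_itv_refine L)[t tL ty]; apply/asboolP; exists t => //.
apply/negP => /asboolP[z Az zt]; have [|_] := yb z; last exact.
apply: (dyadic_itv_sub_cball ty) zt; rewrite size_cat tL size_takel; last lia.
rewrite exprD invfM !exprS !invfM.
have : 0 < 2 ^- m :> R by rewrite invr_gt0 exprn_gt0.
have : 0 < 2 ^- L :> R by rewrite invr_gt0 exprn_gt0.
nra.
Qed.

(** Of at least p n / 2 porous scales, all but 3 + 2 [nerr 0 u] yield distinct prefixes with a hole;
    the bounds on [n] and [q] make 3 and 2 [nerr 0 u] at most p n / 8 each. *)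
Lemma many_holes A x a p u n q L : 0 < a -> 0 < p -> 2 ^- L <= a / 8 ->
  size u = n -> dyadic_itv u x -> (q * nerr 0 u < n)%N -> 16 / p <= q%:R ->
  24 / p <= n%:R ->
  p / 2 <= scale_freq (fun j => por_set A x (2 ^- j)) a n ->
  p / 4 * n%:R <= (\sum_(m < n) has_hole A L (take m u))%N%:R.
Proof.
move=> a0 p0 La su ux eu qp np.
pose P j := (a%:E <= por_set A x (2 ^- j))%E.
pose H j := has_hole A L (take (j - 2) u).
have cnt : (n <= count (predU (predC P) H) (iota 1 n) + 2 + 2 * nerr 0 u)%N.
  apply: count_bad_windows; [lia | lia | move=> j /andP[j2 jn] ju].
  rewrite /= -implybE; apply/implyP => Pj.
  apply: (por_set_hole a0 La _ ju ux); first lia.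
  by have -> : (j - 2).+2 = j by lia.
have cU := count_predUI (predC P) H (iota 1 n).
have cC := count_predC P (iota 1 n); rewrite size_iota in cC.
have cS k : count H (iota 1 k.+1) = (count H (iota 1 k) + H k.+1)%N.
  by rewrite -[X in iota _ X]addn1 iotaD count_cat /= addn0 add1n.
(* Scales 1 and 2 both refer to the empty prefix, hence the extra unit. *)
have cH i : (count H (iota 1 i.+1) <= (\sum_(m < i) has_hole A L (take m u)).+1)%N.
  elim: i => [|i IH]; first by rewrite big_ord0 /= addn0 leq_b1.
  by rewrite cS big_ord_recr -addSn leq_add// /H subSS subSS subn0.
have {}cH : (count H (iota 1 n) <= (\sum_(m < n) has_hole A L (take m u)).+1)%N.
  case: (n) => [//|i]; apply: leq_trans (cH i) _.
  by rewrite big_ord_recr /= ltnS leq_addr.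
rewrite /scale_freq -/P.
have n0 : 0 < n%:R :> R by rewrite (lt_le_trans _ np)// divr_gt0.
rewrite ler_pdivlMr// => CP.
have {}cnt : (count P (iota 1 n) <=
    \sum_(m < n) has_hole A L (take m u) + 3 + 2 * nerr 0 u)%N.
  by move: cnt cU cC cH; lia.
have {}cnt : (count P (iota 1 n))%:R <=
    (\sum_(m < n) has_hole A L (take m u))%N%:R + 3 + 2 * (nerr 0 u)%:R :> R.
  by rewrite -natrM -!natrD ler_nat.
have {}eu : q%:R * (nerr 0 u)%:R <= n%:R :> R by rewrite -natrM ler_nat ltnW.
have h1 : 16 * (nerr 0 u)%:R <= n%:R * p.
  rewrite -ler_pdivrMr// mulrAC (le_trans _ eu)// ler_wpM2r//.
have h2 : 24 <= n%:R * p by rewrite -ler_pdivrMr.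
nra.
Qed.

End MeanPorousSets.

(** * Mean porous sets are null *)

Section BetaZero.
Variables (R : realType) (mu : probability (measurableTypeR R) R).
Hypothesis hmu : is_dyadic_measure mu.
Implicit Types (A : set R) (u v : seq bool) (x y r a p c K : R).

Definition many_holes_above A L n K : set R :=
  [set x | exists u, [/\ size u = n, meets A u &&
    (K <= (\sum_(m < n) has_hole A L (take m u))%N%:R) & dyadic_itv u x] ].

Lemma outer_many_holes_above A L n c K : 0 < c -> 0 < K ->
  (forall m t, (m < n)%N -> size t = L -> c <= word_prob R m t) ->
  (mu^*%mu (many_holes_above A L n K) <= (L%:R / (c * K))%:E)%E.
Proof.
move=> c0 K0 cw.
have := @outer_dyadic_cover R mu hmu (many_holes_above A L n K) n [::]
  (fun u => meets A u &&
  (K <= (\sum_(m < n) has_hole A L (take m u))%N%:R)) (fun x h => h).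
by move=> /le_trans; apply; rewrite /= mul1r lee_fin; exact: many_holes_rare.
Qed.

(** At one large level [n] each point of the set has either many errors or many holes above it; both
    cases have outer measure at most e / 2. *)
Lemma outer_uniformly_porous0 A a p N : 0 < a -> 0 < p ->
  mu^*%mu [set x | [/\ A x, 0 <= x <= 1 & forall i, (N <= i)%N ->
    p / 2 <= scale_freq (fun j => por_set A x (2 ^- j)) a i] ] = 0%E.
Proof.
move=> a0 p0; set B := [set x | _].
apply/eqP; rewrite eq_le outer_measure_ge0 andbT.
apply/lee_addgt0Pr => e e0; rewrite add0e.
have [L La] : exists L, 2 ^- L <= a / 8 by apply: dyadic_small; lra.
have [q qp] := nat_above (16 / p).
have [N1 [C C0 NC]] := outer_many_errors hmu q.
have [N2 _ N2C] : \forall n \near \oo, C * (3 / 4) ^+ n < e / 2.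
  have : C * (3 / 4) ^+ n @[n --> \oo] --> (0 : R).
    rewrite -[X in _ --> X](mulr0 C).
    by apply: cvgMr; apply: cvg_expr; rewrite gtr0_norm; lra.
  by move=> /cvgr_lt; apply; lra.
have k0 : 0 < 1 - w R 1 by rewrite subr_gt0 w1_lt1.
(* This constant is what L / (c K) <= e / 2 requires for the [c] and [K] below. *)
have [N3 N3w] := w_slow L (8 * L%:R / ((1 - w R 1) ^+ L * p * e)).
have [N4 N4p] := nat_above (24 / p).
have [n [n1 nN nN1 [nN2 nN3 nN4]]] : exists n, [/\ 0 < n, N <= n, N1 <= n &
    [/\ N2 <= n, N3 <= n & N4 <= n]]%N.
  by exists (N + N1 + N2 + N3 + N4).+1; split; [| | | split]; lia.
have n0 : 0 < n%:R :> R by rewrite ltr0n.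
have w0 : 0 < w R (n + L) by apply: w_gt0; rewrite ltn_addr.
pose c := ((1 - w R 1) * w R (n + L)) ^+ L.
have c0 : 0 < c by rewrite exprn_gt0// mulr_gt0.
pose K := p / 4 * n%:R.
have K0 : 0 < K by rewrite !mulr_gt0.
have cw m t : (m < n)%N -> size t = L -> c <= word_prob R m t.
  by move=> mn tL; rewrite /c -tL; apply: word_prob_ge; clear -mn; lia.
have sub : B `<=` many_errors q n `|` many_holes_above A L n K.
  move=> x [Ax x01 xp]; have [u su ux] := unit_dyadic_cover n x01.
  have [nu|un] := leqP n (q * nerr 0 u); first by left; exists u.
  right; exists u; split=> //; apply/andP; split; first by apply/asboolP; exists x.
  apply: many_holes a0 p0 La su ux un qp _ _.
    by rewrite (le_trans N4p)// ler_nat.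
  exact: xp.
apply: le_trans (le_outer mu sub) _; apply: le_trans (outerU mu _ _) _.
rewrite (splitr e) EFinD leeD//.
  apply: le_trans (NC n nN1) _; rewrite lee_fin ltW//; exact: N2C.
apply: le_trans (outer_many_holes_above A c0 K0 cw) _.
rewrite lee_fin ler_pdivrMr ?mulr_gt0//.
have := N3w n; rewrite ler_pdivrMr ?mulr_gt0 ?exprn_gt0// => /(_ _) h.
have {}h : 8 * L%:R <= w R (n + L) ^+ L * n%:R * ((1 - w R 1) ^+ L * p * e).
  exact: h.
rewrite /c /K exprMn.
have -> : e / 2 * ((1 - w R 1) ^+ L * w R (n + L) ^+ L * (p / 4 * n%:R)) =
  w R (n + L) ^+ L * n%:R * ((1 - w R 1) ^+ L * p * e) / 8 by field.
lra.
Qed.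

Lemma mean_porous_set_null A a p : 0 < a -> 0 < p -> mean_porous_set a p A ->
  mu^*%mu A = 0%E.
Proof.
move=> a0 p0 Ap.
pose B N := [set x | [/\ A x, 0 <= x <= 1 & forall i, (N <= i)%N ->
  p / 2 <= scale_freq (fun j => por_set A x (2 ^- j)) a i] ].
apply: (@outer_sub0 _ _ _ ((~` `[0, 1]%classic) `|` \bigcup_N B N)).
  move=> x Ax; have [x01|nx] := boolP (0 <= x <= 1); last first.
    by left; rewrite /= in_itv; exact/negP.
  have h : ((p / 2)%:E < limn_einf
      (fun i => (scale_freq (fun j => por_set A x (2 ^- j)) a i)%:E))%E.
    by apply: lt_le_trans (Ap x Ax); rewrite lte_fin; lra.
  have [N xN] := limn_einf_gt h; right; exists N => //; split=> //.
apply/eqP; rewrite eq_le outer_measure_ge0 andbT.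
apply: le_trans (outerU mu _ _) _.
rewrite outer_unit_compl// add0e outer_bigcup0// => N.
exact: outer_uniformly_porous0.
Qed.

(** For porosity 0 a hole is a single point outside [A], since [cball y 0] is a singleton; so every
    scale counts. *)
Lemma mean_porous_set0 A p : p <= 1 ->
  (forall x r, 0 < r -> exists2 y, cball x r y & ~ A y) -> mean_porous_set 0 p A.
Proof.
(* The bound starts at 1 because [scale_freq] at 0 is 0 / 0 = 0. *)
move=> p1 nA x Ax; apply: (@limn_einf_ge _ _ _ 1) => i i1.
rewrite lee_fin /scale_freq (eq_count (a2 := predT)); last first.
  move=> j /=; apply/idP; apply: ereal_sup_ubound; exists 0 => //; split=> //.
  have r0 : 0 < 2 ^- j :> R by rewrite invr_gt0 exprn_gt0.
  have [y xy nAy] := nA x _ r0; exists y => z /cballP zy.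
  by have -> : z = y by lra.
by rewrite count_predT size_iota divff// pnatr_eq0; lia.
Qed.

Lemma dense_rational x r : 0 < r -> exists2 y, cball x r y & @rational R y.
Proof.
move=> r0; have xr : x < x + r by lra.
have [q] := rat_in_itvoo xr; rewrite in_itv /= => /andP[xq qr].
by exists (ratr q); [apply/cballP; lra | exists q].
Qed.

(** A rational [x] is moved by the small irrational [pi - ratr q]. *)
Lemma dense_irrational x r : 0 < r -> exists2 y, cball x r y & ~ @rational R y.
Proof.
move=> r0; have [[p _ px]|nx] := pselect (@rational R x); last first.
  by exists x => //; apply/cballP; lra.
have h : pi - r < pi :> R by lra.
have [q] := rat_in_itvoo h; rewrite in_itv /= => /andP[rq qp].
exists (x + (pi - ratr q)); first by apply/cballP; lra.
move=> [t _ tE]; apply: (@pi_irrationnal R); exists (t - p + q) => //.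
by rewrite rmorphD rmorphB /= tE px; ring.
Qed.

(* Both the rationals and the irrationals have dense complement, and they cannot
   both be null. *)
Lemma exists_mean_porous_set0 p : p <= 1 ->
  exists A, mean_porous_set 0 p A /\ (0 < mu^*%mu A)%E.
Proof.
move=> p1; have [Q0|Q0] := eqVneq (mu^*%mu (@rational R)) 0%E; last first.
  exists (@rational R); split; last by rewrite lt_neqAle eq_sym Q0 outer_measure_ge0.
  by apply: mean_porous_set0 => // x r; exact: dense_irrational.
exists (~` @rational R); split.
  apply: mean_porous_set0 => // x r /(dense_rational x)[y xy Qy].
  by exists y => //; exact.
have sub : `[0, 1]%classic `<=` @rational R `|` ~` @rational R.
  by move=> x _; exact: EM.
have := le_trans (le_outer mu sub) (outerU mu _ _).
rewrite outer_unit// Q0 add0e; apply: lt_le_trans; exact: lte01.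
Qed.

Lemma beta_eq0 p : 0 < p -> p <= 1 -> beta p mu = 0%E.
Proof.
move=> p0 p1; apply/eqP; rewrite eq_le; apply/andP; split.
  apply: ge_ereal_sup => _ [a [a0 [A [Aap muA]]] <-].
  rewrite lee_fin leNgt; apply/negP => {}a0.
  by move: muA; rewrite (mean_porous_set_null a0 p0 Aap) ltxx.
(* The value 0 must be attained, since the supremum of the empty set is -oo. *)
apply: ereal_sup_ubound; exists 0 => //; split=> //.
exact: exists_mean_porous_set0.
Qed.

End BetaZero.

Theorem theorem4p1 (R : realType) (mu : probability (measurableTypeR R) R)
    (hmu : is_dyadic_measure mu) :
  [/\ forall p : R, 0 < p -> p <= 1 -> beta p mu = 0%E,
      porous_measure mu (1 / 8) &
      forall a : R, 0 <= a -> a < 1 / 2 -> mean_porous_measure mu a 1].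
Proof.
split=> [p||a]; first exact: beta_eq0; first exact: porous_measure_eighth.
exact: mean_porous_measure_half.
Qed.
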